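(* Let $q$ be a prime power and let $n\in\{2,3\}$. Then there are no non-trivial perfect linear flag-rank-metric codes in $\mathrm{U}(n,\mathbb{F}_q)$; that is, no linear flag-rank-metric code $\mathcal{C}\subsetneq \mathrm{U}(n,\mathbb{F}_q)$ is perfect.
   Context: $\mathbb{F}_q$ is the finite field with $q$ elements. $\mathrm{U}(n,\mathbb{F}_q)$ is the $\mathbb{F}_q$-vector space of $n\times n$ upper triangular matrices over $\mathbb{F}_q$. For $M\in \mathrm{U}(n,\mathbb{F}_q)$ and $1\le i\le n$, $M_{[i]}$ is the $i\times(n-i+1)$ submatrix of $M$ obtained by deleting the first $i-1$ columns and the last $n-i$ rows (i.e. rows $1,\dots,i$ and columns $i,\dots,n$). The flag-rank weight of $M$ is $\mathrm{fr}(M)=\sum_{i=1}^{n}\mathrm{rk}(M_{[i]})$; the flag-rank distance is $\mathrm{d}_{\mathrm{fr}}(A,B)=\mathrm{fr}(A-B)$. A linear flag-rank-metric code is an $\mathbb{F}_q$-subspace $\mathcal{C}$ of $\mathrm{U}(n,\mathbb{F}_q)$; its minimum (flag-rank) distance, defined when $\mathcal{C}\neq\{\boldsymbol{0}\}$, is $\delta=\min\{\mathrm{fr}(M):M\in\mathcal{C}\setminus\{\boldsymbol{0}\}\}$. Let $b_q(n,t)=|\{A\in \mathrm{U}(n,\mathbb{F}_q):\mathrm{fr}(A)\le t\}|$. A (nonzero) code $\mathcal{C}$ with minimum distance $\delta$ is perfect if $|\mathcal{C}|\,b_q(n,t)=q^{\frac{n(n+1)}{2}}$, where $t=\left\lfloor\frac{\delta-1}{2}\right\rfloor$.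 The code $\mathcal{C}=\mathrm{U}(n,\mathbb{F}_q)$ is the trivial perfect code. *)

(* Defs.v *)
From mathcomp Require Import all_boot all_order all_algebra all_field.

Set Implicit Arguments.
Unset Strict Implicit.
Unset Printing Implicit Defensive.

Import GRing.Theory.
Local Open Scope nat_scope.

(* [is_trig_mx] means lower triangular, hence the transpose. *)
Definition upper_tri (F : finFieldType) (n : nat) : {set 'M[F]_n} :=
  [set M | is_trig_mx M^T].

(* Indices start at 0: for i in {0, .., n-1}, this is the submatrix M_[i+1] of
   rows 0, .., i and columns i, .., n-1. *)
Definition flag_submx (F : finFieldType) (n : nat) (M : 'M[F]_n) (i : 'I_n) :
    'M[F]_(i.+1, n - i) :=
  mxsub (widen_ord (ltn_ord i))
        (fun k => cast_ord (subnKC (ltnW (ltn_ord i))) (rshift i k)) M.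

Definition flag_rank (F : finFieldType) (n : nat) (M : 'M[F]_n) : nat :=
  \sum_(i < n) \rank (flag_submx M i).

Definition linear_fr_code (F : finFieldType) (n : nat)
    (C : {vspace 'M[F]_n}) : bool :=
  C \subset upper_tri F n.

(* [vpick C] is a nonzero element of C when C is nonzero; the value for the zero
   code is junk. *)
Definition min_fr_distance (F : finFieldType) (n : nat)
    (C : {vspace 'M[F]_n}) : nat :=
  flag_rank [arg min_(M < vpick C | (M \in C) && (M != 0%R)) flag_rank M].

Definition fr_ball_size (F : finFieldType) (n t : nat) : nat :=
  #|[set A in upper_tri F n | flag_rank A <= t]|.

Definition perfect_fr_code (F : finFieldType) (n : nat)
    (C : {vspace 'M[F]_n}) : Prop :=
  C != 0%VS /\
  #|C| * fr_ball_size F n ((min_fr_distance C - 1) %/ 2)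
    = #|F| ^ (n * (n + 1) %/ 2).

(* Main.v *)
Require Import Defs.
From mathcomp Require Import all_boot all_order all_algebra all_field.
From mathcomp Require Import zify.

Set Implicit Arguments.
Unset Strict Implicit.
Unset Printing Implicit Defensive.

Import GRing.Theory.
Local Open Scope nat_scope.

(** The flag-rank weight is at most 2 for n = 2 and at most 4 for n = 3, so a
    packing radius t >= 1 forces n = 3, t = 1 and minimum distance at least 3.
    If t = 0 the balls are singletons, and a perfect code has as many elements
    as U(n, F_q).  If n = 3 and t = 1, a matrix whose last column vanishes has
    weight at most 2, so a codeword is determined by its last column and
    |C| <= q^3; a matrix of weight at most 1 is diagonal, and the identity has
    larger weight, so the ball has fewer than q^3 elements.  Hence the product
    is less than q^6. *)

Section FlagRank.

Variables (F : finFieldType) (n : nat).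
Implicit Types (A M : 'M[F]_n) (C : {vspace 'M[F]_n}).

Lemma upper_triP A :
  reflect (forall i j : 'I_n, j < i -> A i j = 0%R) (A \in upper_tri F n).
Proof.
rewrite inE; apply: (iffP is_trig_mxP) => [A0 i j ltji | A0 i j ltij].
  by have := A0 j i ltji; rewrite mxE.
by rewrite mxE; apply: A0.
Qed.

(** Grouping the pairs by their larger index [j] gives [j.+1] choices for the smaller one, and these
    sum to a binomial coefficient. *)
Lemma card_ord_le_pairs :
  #|{: {ij : 'I_n * 'I_n | ij.1 <= ij.2}}| = n * (n + 1) %/ 2.
Proof.
rewrite card_sig -sum1_card.
rewrite -(pair_big_dep xpredT (fun i j : 'I_n => i <= j) (fun _ _ => 1)) /=.
rewrite (exchange_big_dep xpredT) //=.
rewrite (eq_bigr (fun j : 'I_n => j.+1)) => [|j _].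
  rewrite -(big_mkord xpredT succn) -(big_add1 _ _ 0 n.+1 xpredT id).
  have := bin2_sum n.+1; rewrite big_nat_recl // add0n big_add1 => ->.
  by rewrite bin2 divn2 mulnC addn1.
rewrite (eq_bigl (fun i : 'I_n => i < j.+1)) => [|i]; last by rewrite ltnS.
by rewrite (big_ord_narrow (ltn_ord j)) sum1_card card_ord.
Qed.

Lemma card_upper_tri_le : #|upper_tri F n| <= #|F| ^ (n * (n + 1) %/ 2).
Proof.
pose f A := [ffun ij : {ij : 'I_n * 'I_n | ij.1 <= ij.2} =>
  A (val ij).1 (val ij).2].
rewrite -card_ord_le_pairs -card_ffun -(card_in_imset (f := f)) ?max_card //.
move=> A B /upper_triP A0 /upper_triP B0 /ffunP eqAB; apply/matrixP => i j.
have [leij | ltji] := leqP i j; last by rewrite A0 ?B0.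
by have := eqAB (exist _ (i, j) leij); rewrite !ffunE.
Qed.

(** For [i <= k <= j], the entry [A i j] sits in [flag_submx A k] at row [i] and column [j - k]. *)
Lemma rank_flag_submx_gt0 A (i j k : 'I_n) :
  i <= k -> k <= j -> A i j != 0%R -> 0 < \rank (flag_submx A k).
Proof.
move=> leik lekj; rewrite lt0n mxrank_eq0; apply: contraNN => /eqP Ak0.
have ltjk : j - k < n - k by apply: ltn_sub2r; rewrite ?(leq_ltn_trans lekj).
have leik' : i < k.+1 by [].
have := congr1 (fun B : 'M_(_, _) => B (Ordinal leik') (Ordinal ltjk)) Ak0.
rewrite !mxE => <-; apply/eqP; congr (A _ _); apply: val_inj => //=.
by rewrite subnKC.
Qed.

Lemma flag_rank_gt0 A : A \in upper_tri F n -> A != 0%R -> 0 < flag_rank A.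
Proof.
move=> /upper_triP A0; apply: contraNT; rewrite -leqNgt leqn0 sum_nat_eq0.
move=> /forallP/= fr0; apply/eqP/matrixP => i j; rewrite mxE; apply/eqP.
have [leij | ltji] := leqP i j; last by rewrite A0.
by apply: contraT => /(rank_flag_submx_gt0 (leqnn i) leij); rewrite lt0n fr0.
Qed.

Lemma flag_rank_ge2 A (i j : 'I_n) : i != j ->
  0 < \rank (flag_submx A i) -> 0 < \rank (flag_submx A j) ->
  1 < flag_rank A.
Proof.
move=> neij Ai Aj.
by rewrite /flag_rank (bigD1 i) //= (bigD1 j) 1?eq_sym //=; lia.
Qed.

Lemma fr_ball_size0_le : fr_ball_size F n 0 <= 1.
Proof.
rewrite -(cards1 (0%R : 'M[F]_n)); apply/subset_leq_card/subsetP => A.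
rewrite inE [_ \in [set 0%R]]inE => /andP[triA]; apply: contraTT => A0.
by rewrite -ltnNge flag_rank_gt0.
Qed.

(** A nonzero entry with [i < j] lies in both flag submatrices [i] and [j], which already forces
    weight 2. *)
Lemma flag_rank_le1_diag A (i j : 'I_n) : A \in upper_tri F n ->
  flag_rank A <= 1 -> i != j -> A i j = 0%R.
Proof.
move=> /upper_triP A0 frA neij; apply/eqP.
have [leij | ltji] := leqP i j; last by rewrite A0.
apply: contraTT frA => Aij; rewrite -ltnNge.
by apply: (flag_rank_ge2 neij); apply: rank_flag_submx_gt0 Aij.
Qed.

Lemma fr_ball_size1_lt : 1 < n -> fr_ball_size F n 1 < #|F| ^ n.
Proof.
move=> n_gt1; pose f A : 'rV[F]_n := (\row_i A i i)%R.
rewrite /fr_ball_size; set B := finset _.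
have f_inj : {in B &, injective f}.
  move=> X Y; rewrite !inE => /andP[triX frX] /andP[triY frY] eqXY.
  apply/matrixP => i j; have [<- | neij] := eqVneq i j.
    by have := congr1 (fun r : 'rV_n => r ord0 i) eqXY; rewrite !mxE.
  by rewrite !flag_rank_le1_diag ?inE.
rewrite -(card_in_imset f_inj) -[n in _ ^ n]mul1n -card_mx -cardsT.
(* The all-ones row is not the diagonal of a matrix in the ball: the nonzero entries at positions 0
   and 1 would give weight at least 2. *)
apply: proper_card; rewrite properT; apply: contraTneq isT => fB.
have /imsetP[X] : const_mx 1%R \in f @: B by rewrite fB inE.
rewrite inE => /andP[_]; rewrite leqNgt => /negP frX eqX; case: frX.
have X1 i : X i i != 0%R.
  have := congr1 (fun r : 'rV_n => r ord0 i) eqX.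
  by rewrite !mxE => <-; apply: oner_neq0.
pose i0 := Ordinal (ltnW n_gt1); pose i1 := Ordinal n_gt1.
by apply: (@flag_rank_ge2 X i0 i1) => //; apply: rank_flag_submx_gt0 (X1 _).
Qed.

Lemma min_fr_distance_le C M :
  M \in C -> M != 0%R -> min_fr_distance C <= flag_rank M.
Proof.
move=> CM M0; rewrite /min_fr_distance; case: arg_minnP => [|N _ minN].
  (* The default [vpick C] is a legitimate candidate here, because [M] witnesses that [C] is
     nonzero. *)
  rewrite memv_pick vpick0; apply: contraNneq M0 => C0.
  by rewrite C0 memv0 in CM.
by apply: minN; rewrite CM.
Qed.

(** The sizes of the flag submatrices bound the weight of every matrix; the sum is 2 for [n = 2] and
    4 for [n = 3]. *)
Lemma min_fr_distance_le_sum C :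
  min_fr_distance C <= \sum_(i < n) minn i.+1 (n - i).
Proof.
apply: leq_sum => i _.
by rewrite leq_min rank_leq_row rank_leq_col.
Qed.

End FlagRank.

(** The three flag submatrices are a single row, a 2 by 2 block whose second column vanishes, and
    the last column itself, so their ranks are at most 1, 1 and 0. *)
Lemma flag_rank_last_col0 (F : finFieldType) (A : 'M[F]_3) :
  col ord_max A = 0%R -> flag_rank A <= 2.
Proof.
move=> /matrixP A0.
have Alast i : A i ord_max = 0%R by have := A0 i ord0; rewrite !mxE.
rewrite /flag_rank !big_ord_recl big_ord0 addn0.
set M1 := flag_submx A _; set M2 := flag_submx A _; set M3 := flag_submx A _.
have rk1 : \rank M1 <= 1 by apply: rank_leq_row.
have rk2 : \rank M2 <= 1.
  (* A column times a row has rank at most 1. *)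
  have -> : M2 = (col (ord0 : 'I_2) M2 *m delta_mx ord0 ord0)%R.
    apply/matrixP => i j; rewrite !mxE big_ord1 !mxE.
    case: j => [[|[|//]] lt_j]; rewrite ?mulr1 ?mulr0.
      by congr (A _ _); apply: val_inj.
    rewrite -[RHS](Alast (widen_ord (ltn_ord (lift ord0 ord0)) i)).
    by congr (A _ _); apply: val_inj.
  exact: mulmx_max_rank.
have -> : M3 = 0%R.
  apply/matrixP => i j; rewrite !mxE.
  rewrite -[RHS](Alast (widen_ord (ltn_ord (lift ord0 (lift ord0 ord0))) i)).
  by congr (A _ _); apply: val_inj; case: j => [[]].
by rewrite mxrank0; lia.
Qed.

(** Two codewords with the same last column differ by a codeword of weight at most 2, which must be
    zero. *)
Lemma card_fr_code3_le (F : finFieldType) (C : {vspace 'M[F]_3}) :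
  2 < min_fr_distance C -> #|C| <= #|F| ^ 3.
Proof.
move=> dC.
have col_inj : {in C &, injective (col ord_max : 'M[F]_3 -> 'cV[F]_3)}.
  move=> X Y CX CY eqXY; apply/eqP; rewrite -subr_eq0.
  apply: contraTT dC => XY0; rewrite -leqNgt.
  apply: leq_trans (min_fr_distance_le (memvB CX CY) XY0) _.
  apply: flag_rank_last_col0; apply/matrixP => i j.
  have := congr1 (fun c : 'cV_3 => c i j) eqXY.
  by rewrite !mxE => ->; rewrite subrr.
rewrite -(card_in_image col_inj) (leq_trans (max_card _)) //.
by rewrite card_mx muln1.
Qed.

Theorem corollary5p2 (F : finFieldType) (n : nat) (hn : n = 2 \/ n = 3)
  (C : {vspace 'M[F]_n}) (hC : linear_fr_code C)
  (hproper : C \proper upper_tri F n) :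
  ~ perfect_fr_code C.
Proof.
case=> _ perfC.
have dC := min_fr_distance_le_sum C.
have [t0 | t_gt0] := posnP ((min_fr_distance C - 1) %/ 2).
  (* Radius 0: properness makes [#|C|] smaller than the power of [#|F|], while perfection with balls
     of size at most 1 makes it at least that. *)
  have := leq_trans (proper_card hproper) (card_upper_tri_le F n).
  rewrite -perfC t0 ltnNge -{2}[#|C|]muln1.
  by rewrite leq_mul2l fr_ball_size0_le orbT.
(* For [n = 2] the distance is at most 2, which contradicts a positive radius. *)
case: hn => n_eq; subst n; rewrite !big_ord_recl big_ord0 /= in dC.
  by move: dC; rewrite /bump /=; lia.
have t1 : (min_fr_distance C - 1) %/ 2 = 1.
  by move: dC t_gt0; rewrite /bump /=; lia.
have cC : #|C| <= #|F| ^ 3 by apply: card_fr_code3_le; lia.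
have ball : fr_ball_size F 3 1 < #|F| ^ 3 by apply: fr_ball_size1_lt.
have q_gt0 : 0 < #|F| ^ 3 by apply: leq_ltn_trans ball.
(* Splitting the exponent 6 as [3 + 3] lets the code and the ball be compared with one factor
   each. *)
move: perfC; rewrite t1 -[_ %/ 2]/(3 + 3) expnD => /eqP; apply/negP.
rewrite ltn_eqF //; apply: (@leq_ltn_trans (#|F| ^ 3 * fr_ball_size F 3 1)).
  by rewrite leq_mul2r cC orbT.
by rewrite ltn_pmul2l.
Qed.
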